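(* Let $(A,\cdot)$ be an associative algebra over a field $\mathbf{k}$ of characteristic $0$ and $N:A\to A$ a Nijenhuis operator. Let $\pi_N\in\mathcal{O}_A(2)$ be given by $\pi_N([1];a,b)=a\cdot N(b)$, $\pi_N([2];a,b)=N(a)\cdot b$, $\pi_N([3];a,b)=-N(a\cdot b)$ (the Maurer–Cartan element encoding the NS-algebra induced by $N$). For $n\ge1$ define $\Theta_n:\mathrm{Hom}(A^{\otimes n},A)\to\mathcal{O}_A(n+1)$ by $$\Theta_n(f)([r];a_1,\dots,a_{n+1})=\begin{cases}(-1)^{n+1}a_1\cdot f(a_2,\dots,a_{n+1}) & r=1,\\ 0 & 2\le r\le n,\\ f(a_1,\dots,a_n)\cdot a_{n+1} & r=n+1,\\ \sum_{i=1}^n(-1)^{n+i+1}f(a_1,\dots,a_i\cdot a_{i+1},\dots,a_{n+1}) & r=n+2.\end{cases}$$ Then $\delta_{\pi_N}\circ\Theta_n=\Theta_{n+1}\circ d_N$ for all $n\ge1$, so $\{\Theta_n\}_{n\ge1}$ is a homomorphism of cochain complexes from $\{\bigoplus_{n\ge1}\mathrm{Hom}(A^{\otimes n},A),d_N\}$ to $\{\bigoplus_{n\ge1}\mathcal{O}_A(n+1),\delta_{\pi_N}\}$, and it induces homomorphisms $\Theta:H^n(N)\to H^{n+1}_{\mathrm{NS}}(A_{\mathrm{NS}})$.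
   Context: A Nijenhuis operator on $(A,\cdot)$ is a linear $N$ with $N(a)N(b)=N(N(a)b+aN(b)-N(ab))$. The map $d_N:\mathrm{Hom}(A^{\otimes n},A)\to\mathrm{Hom}(A^{\otimes n+1},A)$ is, for $n\ge1$, $(d_Nf)(a_1,\dots,a_{n+1})=N(a_1)\cdot f(a_2,\dots,a_{n+1})-(-1)^nf(a_1,\dots,a_n)\cdot N(a_{n+1})+\sum_{i=1}^n(-1)^if(a_1,\dots,a_{i-1},N(a_i)a_{i+1}+a_iN(a_{i+1})-N(a_ia_{i+1}),\dots,a_{n+1})-N\big((\delta_{\mathrm{Hoch}}f)(a_1,\dots,a_{n+1})\big)$, where $(\delta_{\mathrm{Hoch}}f)(a_1,\dots,a_{n+1})=a_1f(a_2,\dots,a_{n+1})+\sum_{i=1}^n(-1)^if(a_1,\dots,a_ia_{i+1},\dots,a_{n+1})+(-1)^{n+1}f(a_1,\dots,a_n)a_{n+1}$; and on $A=\mathrm{Hom}(A^{\otimes0},A)$, $d_N(a)(b)=N(b)a-aN(b)-N(ba-ab)$. Then $d_N^2=0$ and $H^\bullet(N)$ denotes the cohomology of $\{\bigoplus_{n\ge0}\mathrm{Hom}(A^{\otimes n},A),d_N\}$. Let $C_n=\{[1],\dots,[n]\}$ be formal symbols. $\mathcal{O}_A(1)=\mathrm{Hom}(\mathbf{k}[C_1]\otimes A,A)$ and $\mathcal{O}_A(n)=\mathrm{Hom}(\mathbf{k}[C_{n+1}]\otimes A^{\otimes n},A)$ for $n\ge2$. For $f\in\mathcal{O}_A(m)$,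 $g\in\mathcal{O}_A(n)$ with $m,n\ge2$ and $1\le i\le m$, write $G_*=\sum_{j=1}^{n+1}g([j];a_i,\dots,a_{i+n-1})$; then $f\circ_ig\in\mathcal{O}_A(m+n-1)$ is: for $1\le r\le i-1$, $f([r];a_1,\dots,a_{i-1},G_*,a_{i+n},\dots,a_{m+n-1})$; for $i\le r\le i+n-1$, $f([i];a_1,\dots,a_{i-1},g([r-i+1];a_i,\dots,a_{i+n-1}),\dots,a_{m+n-1})$; for $i+n\le r\le m+n-1$, $f([r-n+1];a_1,\dots,a_{i-1},G_*,\dots,a_{m+n-1})$; for $r=m+n$, $f([i];\dots,g([n+1];a_i,\dots,a_{i+n-1}),\dots)+f([m+1];\dots,G_*,\dots)$. Set $[\![f,g]\!]=\sum_{i=1}^m(-1)^{(i-1)(n-1)}f\circ_ig-(-1)^{(m-1)(n-1)}\sum_{i=1}^n(-1)^{(i-1)(m-1)}g\circ_if$ and, for an NS-algebra structure $\pi\in\mathcal{O}_A(2)$, $\delta_\pi(f)=(-1)^{n-1}[\![\pi,f]\!]$ for $f\in\mathcal{O}_A(n)$. $H^\bullet_{\mathrm{NS}}$ is the cohomology of $\{\bigoplus_{n\ge1}\mathcal{O}_A(n),\delta_\pi\}$; $A_{\mathrm{NS}}$ is the NS-algebra $(A,\prec_N,\succ_N,\curlyvee_N)$ with $a\prec_Nb=a\cdot N(b)$, $a\succ_Nb=N(a)\cdot b$, $a\curlyvee_Nb=-N(a\cdot b)$, corresponding to $\pi=\pi_N$. *)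

(* Defs.v *)
From mathcomp Require Import all_boot all_order all_algebra.
Set Implicit Arguments. Unset Strict Implicit. Unset Printing Implicit Defensive.
Import Order.TTheory GRing.Theory Num.Theory.
Local Open Scope ring_scope.

(* Conventions: a (possibly non-unital) associative k-algebra is a k-module
   A with a multiplication mul : A -> A -> A (bilinearity/associativity are
   hypotheses of the theorem).  An element of Hom(A^{ox n}, A) is represented
   by a function f : seq A -> A which is multilinear on lists of size n
   (its values on lists of other sizes are irrelevant).  An element of
   O_A(n) = Hom(k[C_{n+1}] ox A^{ox n}, A) is represented by
   F : nat -> seq A -> A, where F r s stands for F([r]; s) (1-based r,
   1 <= r <= n+1, size s = n).  All list positions in the formulas below are
   1-based as in the paper: a_j = nth 0 s (j-1). *)

Section Defs.
Variables (k : fieldType) (A : lmodType k).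
Implicit Types (mul : A -> A -> A) (N : A -> A).

Definition sgn (e : nat) (v : A) : A := (-1) ^+ e *: v.

Definition multilinear (n : nat) (f : seq A -> A) : Prop :=
  forall (s : seq A) (i : nat), size s = n -> (i < n)%N ->
  forall (c : k) (x y : A),
    f (set_nth 0 s i (c *: x + y)) =
    c *: f (set_nth 0 s i x) + f (set_nth 0 s i y).

(* replace a_i, a_{i+1} (1-based i) by op a_i a_{i+1} *)
Definition contract (op : A -> A -> A) (i : nat) (s : seq A) : seq A :=
  take i.-1 s ++ op (nth 0 s i.-1) (nth 0 s i) :: drop i.+1 s.

Definition is_Nijenhuis mul N : Prop :=
  forall a b, mul (N a) (N b) = N (mul (N a) b + mul a (N b) - N (mul a b)).

Definition brN mul N (a b : A) : A := mul (N a) b + mul a (N b) - N (mul a b).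

(* Hochschild coboundary of f of arity n (input of size n+1) *)
Definition hoch mul (n : nat) (f : seq A -> A) (s : seq A) : A :=
  mul (nth 0 s 0) (f (behead s))
  + \sum_(1 <= i < n.+1) sgn i (f (contract mul i s))
  + sgn n.+1 (mul (f (take n s)) (nth 0 s n)).

Definition dN mul N (n : nat) (f : seq A -> A) (s : seq A) : A :=
  mul (N (nth 0 s 0)) (f (behead s))
  - sgn n (mul (f (take n s)) (N (nth 0 s n)))
  + \sum_(1 <= i < n.+1) sgn i (f (contract (brN mul N) i s))
  - N (hoch mul n f s).

Definition subst_block (i n : nat) (X : A) (s : seq A) : seq A :=
  take i.-1 s ++ X :: drop (i.-1 + n) s.

Definition block (i n : nat) (s : seq A) : seq A := take n (drop i.-1 s).

Definition pcomp (m n i : nat) (f g : nat -> seq A -> A) : nat -> seq A -> A :=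
  fun r s =>
    let sl := block i n s in
    let Gs := \sum_(1 <= j < n.+2) g j sl in
    if (r <= i.-1)%N then f r (subst_block i n Gs s)
    else if (r <= i + n - 1)%N then f i (subst_block i n (g (r - i + 1)%N sl) s)
    else if (r <= m + n - 1)%N then f (r - n + 1)%N (subst_block i n Gs s)
    else if r == (m + n)%N then
      f i (subst_block i n (g n.+1 sl) s) + f m.+1 (subst_block i n Gs s)
    else 0.

Definition nsbracket (m n : nat) (f g : nat -> seq A -> A) : nat -> seq A -> A :=
  fun r s =>
    \sum_(1 <= i < m.+1) sgn ((i - 1) * (n - 1)) (pcomp m n i f g r s)
    - sgn ((m - 1) * (n - 1))
        (\sum_(1 <= i < n.+1) sgn ((i - 1) * (m - 1)) (pcomp n m i g f r s)).

Definition deltaNS (pi : nat -> seq A -> A) (n : nat) (F : nat -> seq A -> A)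
  : nat -> seq A -> A :=
  fun r s => sgn (n - 1) (nsbracket 2 n pi F r s).

Definition piN mul N : nat -> seq A -> A :=
  fun r s =>
    let a := nth 0 s 0 in let b := nth 0 s 1 in
    if r == 1%N then mul a (N b)
    else if r == 2%N then mul (N a) b
    else if r == 3%N then - N (mul a b)
    else 0.

Definition Theta mul (n : nat) (f : seq A -> A) : nat -> seq A -> A :=
  fun r s =>
    if r == 1%N then sgn n.+1 (mul (nth 0 s 0) (f (behead s)))
    else if (r <= n)%N then 0
    else if r == n.+1 then mul (f (take n s)) (nth 0 s n)
    else if r == n.+2 then
      \sum_(1 <= i < n.+1) sgn (n + i + 1) (f (contract mul i s))
    else 0.

End Defs.

(* Main.v *)
(* The cochain Theta_n f has only three non-zero components, [1], [n+1] and
   [n+2], and they add up to (-1)^(n+1) times the Hochschild coboundary of f;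
   likewise the three components of pi_N add up to the deformed product
   a *_N b = N(a)b + aN(b) - N(ab).  Expanding delta_{pi_N}(Theta_n f)([r]; -)
   through the partial compositions therefore leaves only a few terms in each
   of the ranges r = 1, 2 <= r <= n+1, r = n+2 and r = n+3.  Comparing them
   with Theta_{n+1}(d_N f)([r]; -), everything matches except double sums
   sum_(i,j) (-1)^(i+j) f(a_1, ..., a_{n+2}) with two adjacent pairs
   contracted, one by [o1] and one by [o2].  Such a sum cancels against the
   one with [o1] and [o2] exchanged as soon as
   o2 (o1 x y) z + o1 (o2 x y) z = o2 x (o1 y z) + o1 x (o2 y z). *)

From mathcomp Require Import all_boot all_order all_algebra zify.
Require Import Defs.
Set Implicit Arguments. Unset Strict Implicit. Unset Printing Implicit Defensive.
Import GRing.Theory.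
Local Open Scope ring_scope.

(* [zmod_eq] proves an identity of a zmodType which holds formally once both
   sides are read as signed sums of opaque atoms: it reifies the two sides
   and checks by computation that the atoms cancel up to permutation. *)
Section ZmodReflection.
Variable V : zmodType.

Inductive zexpr := ZAtom of nat | ZAdd of zexpr & zexpr | ZOpp of zexpr | ZZero.

Fixpoint zeval (env : seq V) (t : zexpr) : V :=
  match t with
  | ZAtom i => nth 0 env i
  | ZAdd a b => zeval env a + zeval env b
  | ZOpp a => - zeval env a
  | ZZero => 0
  end.

Fixpoint zatoms (t : zexpr) : seq (bool * nat) :=
  match t with
  | ZAtom i => [:: (false, i)]
  | ZAdd a b => zatoms a ++ zatoms b
  | ZOpp a => map (fun p => (~~ p.1, p.2)) (zatoms a)
  | ZZero => [::]
  end.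

Definition zsum (env : seq V) (l : seq (bool * nat)) : V :=
  \sum_(p <- l) (if p.1 then - nth 0 env p.2 else nth 0 env p.2).

Lemma zeval_atoms env t : zeval env t = zsum env (zatoms t).
Proof.
elim: t => [i|a iha b ihb|a iha|] /=.
- by rewrite /zsum big_cons big_nil addr0.
- by rewrite iha ihb /zsum big_cat.
- rewrite iha /zsum big_map -sumrN; apply: eq_bigr => -[[] j] _ //=.
  by rewrite opprK.
- by rewrite /zsum big_nil.
Qed.

Lemma zeval_eq env t1 t2 :
  let l := zatoms (ZAdd t1 (ZOpp t2)) in
  perm_eq [seq p.2 | p <- l & ~~ p.1] [seq p.2 | p <- l & p.1] ->
  zeval env t1 = zeval env t2.
Proof.
move=> l hperm; apply/eqP; rewrite -subr_eq0.
rewrite -[_ - _]/(zeval env (ZAdd t1 (ZOpp t2))) zeval_atoms -/l /zsum.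
rewrite (bigID (fun p => p.1)) /=.
have -> : \sum_(p <- l | p.1) (if p.1 then - nth 0 env p.2 else nth 0 env p.2)
    = - \sum_(i <- [seq p.2 | p <- l & p.1]) nth 0 env i.
  by rewrite big_map big_filter -sumrN; apply: eq_bigr => p ->.
have -> : \sum_(p <- l | ~~ p.1) (if p.1 then - nth 0 env p.2 else nth 0 env p.2)
    = \sum_(i <- [seq p.2 | p <- l & ~~ p.1]) nth 0 env i.
  by rewrite big_map big_filter; apply: eq_bigr => p /negbTE ->.
by rewrite (perm_big _ hperm) addNr.
Qed.

End ZmodReflection.

Ltac zenv_size env :=
  lazymatch env with
  | nil => constr:(0%N)
  | cons _ ?e => let n := zenv_size e in constr:(S n)
  end.

Ltac zenv_index x env :=
  lazymatch env with
  | cons ?y ?e =>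
      match constr:(tt) with
      | _ => let _ := match goal with _ => unify x y end in constr:(0%N)
      | _ => let n := zenv_index x e in constr:(S n)
      end
  end.

Ltac zenv_rcons env x :=
  lazymatch env with
  | nil => constr:([:: x])
  | cons ?y ?e => let e' := zenv_rcons e x in constr:(y :: e')
  end.

Ltac zreify env t :=
  lazymatch t with
  | @GRing.add _ ?a ?b =>
      lazymatch zreify env a with (?ta, ?env1) =>
      lazymatch zreify env1 b with (?tb, ?env2) => constr:((ZAdd ta tb, env2))
      end end
  | @GRing.opp _ ?a =>
      lazymatch zreify env a with (?ta, ?env1) => constr:((ZOpp ta, env1)) end
  | @GRing.zero _ => constr:((ZZero, env))
  | _ =>
      match constr:(tt) with
      | _ => let i := zenv_index t env in constr:((ZAtom i, env))
      | _ => let i := zenv_size env in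
             let env' := zenv_rcons env t in constr:((ZAtom i, env'))
      end
  end.

Ltac zmod_eq :=
  lazymatch goal with |- @eq ?V ?lhs ?rhs =>
  lazymatch zreify (@nil V) lhs with (?t1, ?env1) =>
  lazymatch zreify env1 rhs with (?t2, ?env) =>
    change (zeval env t1 = zeval env t2); apply: zeval_eq; by vm_compute
  end end end.

(* Terms [size s] may occur at several convertible but syntactically distinct
   element types, which [lia] would treat as unrelated atoms. *)
Ltac size_lia :=
  repeat match goal with H : context [size _] |- _ => revert H end;
  repeat match goal with |- context [size ?s] =>
    let m := fresh "m" in set m := size s; clearbody m end;
  intros; lia.

Ltac case_ifs := repeat (case: ifP => /= ?); try (exfalso; size_lia).

Ltac congr_index := first
  [ reflexivity | (f_equal; size_lia) | (f_equal; f_equal; size_lia) ].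

Section Signs.
Variables (k : fieldType) (A : lmodType k).
Implicit Types (u v : A) (e : nat).

Lemma sgnE e v : sgn e v = if odd e then - v else v.
Proof.
by rewrite /sgn -signr_odd; case: (odd e); rewrite ?expr1 ?scaleN1r ?expr0 ?scale1r.
Qed.

Lemma sgn0 v : sgn 0 v = v. Proof. by rewrite sgnE. Qed.
Lemma sgnr0 e : sgn e (0 : A) = 0. Proof. exact: scaler0. Qed.
Lemma sgnDr e u v : sgn e (u + v) = sgn e u + sgn e v. Proof. exact: scalerDr. Qed.
Lemma sgnN e v : sgn e (- v) = - sgn e v. Proof. exact: scalerN. Qed.
Lemma sgnB e u v : sgn e (u - v) = sgn e u - sgn e v. Proof. by rewrite sgnDr sgnN. Qed.

Lemma sgn_sum e I (r : seq I) (P : pred I) (F : I -> A) :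
  sgn e (\sum_(i <- r | P i) F i) = \sum_(i <- r | P i) sgn e (F i).
Proof. exact: scaler_sumr. Qed.

Lemma eq_sgn a b v : odd a = odd b -> sgn a v = sgn b v.
Proof. by rewrite !sgnE => ->. Qed.

Lemma sgnD a b v : sgn (a + b) v = sgn a (sgn b v).
Proof. by rewrite !sgnE oddD; case: (odd a); case: (odd b); rewrite /= ?opprK. Qed.

Lemma sgnS e v : sgn e.+1 v = - sgn e v.
Proof. by rewrite -addn1 addnC sgnD sgnE. Qed.

Lemma sgnK e v : sgn e (sgn e v) = v.
Proof. by rewrite -sgnD sgnE addnn odd_double. Qed.

Lemma sgnC a b v : sgn a (sgn b v) = sgn b (sgn a v).
Proof. by rewrite -!sgnD addnC. Qed.

Lemma eq_sum_sgn (E D : nat -> nat) c (X Y : nat -> A) a b :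
    (forall i, (a <= i < b)%N -> sgn (E i) (X i) = sgn c (sgn (D i) (Y i))) ->
  \sum_(a <= i < b) sgn (E i) (X i) = sgn c (\sum_(a <= i < b) sgn (D i) (Y i)).
Proof. by move=> eqXY; rewrite sgn_sum; apply: eq_big_nat. Qed.

End Signs.

Section ScaleAdditive.
Variables (k : fieldType) (A : lmodType k) (g : A -> A).
Hypothesis g_lin : forall (c : k) (x y : A), g (c *: x + y) = c *: g x + g y.

Lemma lin0 : g 0 = 0.
Proof.
have := g_lin 1 0 0; rewrite scaler0 addr0 scale1r => /eqP.
by rewrite -subr_eq addrN eq_sym => /eqP.
Qed.

Lemma linD x y : g (x + y) = g x + g y.
Proof. by have := g_lin 1 x y; rewrite !scale1r. Qed.

Lemma linZ c x : g (c *: x) = c *: g x.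
Proof. by have := g_lin c x 0; rewrite !addr0 lin0 addr0. Qed.

Lemma linN x : g (- x) = - g x.
Proof. by rewrite -scaleN1r linZ scaleN1r. Qed.

Lemma linB x y : g (x - y) = g x - g y.
Proof. by rewrite linD linN. Qed.

Lemma lin_sgn e x : g (sgn e x) = sgn e (g x).
Proof. exact: linZ. Qed.

Lemma lin_sum I (r : seq I) (P : pred I) (F : I -> A) :
  g (\sum_(i <- r | P i) F i) = \sum_(i <- r | P i) g (F i).
Proof. exact: (big_morph g linD lin0). Qed.

End ScaleAdditive.

Lemma double_eq0 (k : fieldType) (A : lmodType k) (v : A) :
  [pchar k] =i pred0 -> v + v = 0 -> v = 0.
Proof.
move=> char0 vv0; have two_neq0 : (2%:R : k) != 0 by rewrite (pcharf0P k).1.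
have : (2%:R : k)^-1 *: (2%:R *: v) = 0 by rewrite scaler_nat -[v *+ 2]/(v + v) vv0 scaler0.
by rewrite scalerA mulVf // scale1r.
Qed.

Lemma sum_nat_eq (V : zmodType) (F : nat -> V) (c a b : nat) :
  \sum_(a <= j < b) (if j == c then F j else 0) = if (a <= c < b)%N then F c else 0.
Proof. by rewrite -big_mkcond big_nat1_eq. Qed.

Lemma big_nat_split_ends (V : zmodType) (G : nat -> V) n : (1 <= n)%N ->
  \sum_(1 <= i < n.+2) G i = G 1%N + \sum_(2 <= i < n.+1) G i + G n.+1.
Proof. by move=> n_gt0; rewrite big_ltn // big_nat_recr //= addrA. Qed.

Section Contraction.
Variables (k : fieldType) (A : lmodType k).
Implicit Types (s : seq A) (o : A -> A -> A).

Lemma size_contract o i s :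
  (1 <= i < size s)%N -> size (contract o i s) = (size s).-1.
Proof. by move=> hi; rewrite /contract size_cat /= size_takel ?size_drop; size_lia. Qed.

Lemma nth_contract o i s j : (1 <= i < size s)%N ->
  nth 0 (contract o i s) j =
    if (j < i.-1)%N then nth 0 s j
    else if j == i.-1 then o (nth 0 s i.-1) (nth 0 s i) else nth 0 s j.+1.
Proof.
move=> hi; rewrite /contract nth_cat size_takel; last size_lia.
case: ifP => hj; first by rewrite nth_take.
have [->|hne] := eqVneq j i.-1; first by rewrite subnn.
have -> : (j - i.-1 = (j - i).+1)%N by size_lia.
by rewrite /= nth_drop; congr nth; size_lia.
Qed.

Lemma contractC o o' p q s : (1 <= p)%N -> (p.+2 <= q)%N -> (q < size s)%N ->
  contract o p (contract o' q s) = contract o' q.-1 (contract o p s).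
Proof.
move=> hp hpq hq; apply: (@eq_from_nth _ 0).
  by rewrite !size_contract ?size_contract; size_lia.
move=> j; rewrite !size_contract; try size_lia.
by move=> hj; rewrite !nth_contract ?size_contract; try size_lia; case_ifs; congr_index.
Qed.

Lemma contract2_right o1 o2 p s : (1 <= p)%N -> (p.+1 < size s)%N ->
  contract o2 p (contract o1 p.+1 s) =
  take p.-1 s ++ o2 (nth 0 s p.-1) (o1 (nth 0 s p) (nth 0 s p.+1)) :: drop p.+2 s.
Proof.
move=> hp hps; apply: (@eq_from_nth _ 0).
  rewrite !size_contract ?size_contract; try size_lia.
  by rewrite size_cat /= size_takel ?size_drop; size_lia.
move=> j; rewrite !size_contract; try size_lia.
move=> hj; rewrite !nth_contract ?size_contract; try size_lia.
rewrite nth_cat size_takel; last size_lia.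
case_ifs; rewrite ?nth_take; try size_lia; try congr_index;
  try (have -> : (j - p.-1 = 0)%N by size_lia); try congr_index.
have -> : (j - p.-1 = (j - p).+1)%N by size_lia.
by rewrite /= nth_drop; congr_index.
Qed.

Lemma contract2_left o1 o2 p s : (1 <= p)%N -> (p.+1 < size s)%N ->
  contract o2 p (contract o1 p s) =
  take p.-1 s ++ o2 (o1 (nth 0 s p.-1) (nth 0 s p)) (nth 0 s p.+1) :: drop p.+2 s.
Proof.
move=> hp hps; apply: (@eq_from_nth _ 0).
  rewrite !size_contract ?size_contract; try size_lia.
  by rewrite size_cat /= size_takel ?size_drop; size_lia.
move=> j; rewrite !size_contract; try size_lia.
move=> hj; rewrite !nth_contract ?size_contract; try size_lia.
rewrite nth_cat size_takel; last size_lia.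
case_ifs; rewrite ?nth_take; try size_lia; try congr_index;
  try (have -> : (j - p.-1 = 0)%N by size_lia); try congr_index.
have -> : (j - p.-1 = (j - p).+1)%N by size_lia.
by rewrite /= nth_drop; congr_index.
Qed.

Lemma behead_contract o i s : (2 <= i < size s)%N ->
  behead (contract o i s) = contract o i.-1 (behead s).
Proof.
move=> hi; apply: (@eq_from_nth _ 0).
  by rewrite size_behead !size_contract ?size_behead; size_lia.
move=> j; rewrite size_behead size_contract; last size_lia.
move=> hj; rewrite nth_behead !nth_contract ?size_behead; try size_lia.
by rewrite !nth_behead; case_ifs; congr_index.
Qed.

Lemma behead_contract1 o s : (2 <= size s)%N ->
  behead (contract o 1 s) = behead (behead s).
Proof. by case: s => [|a [|b s]] //= _; rewrite /contract /= drop0. Qed.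

Lemma nth0_contract o i s : (2 <= i < size s)%N ->
  nth 0 (contract o i s) 0 = nth 0 s 0.
Proof. by move=> hi; rewrite nth_contract; [case_ifs | size_lia]. Qed.

Lemma nth0_contract1 o s : (2 <= size s)%N ->
  nth 0 (contract o 1 s) 0 = o (nth 0 s 0) (nth 0 s 1).
Proof. by move=> hs; rewrite nth_contract; [case_ifs | size_lia]. Qed.

Lemma block_pair i s : (1 <= i < size s)%N -> block i 2 s = [:: nth 0 s i.-1; nth 0 s i].
Proof.
move=> hi; apply: (@eq_from_nth _ 0); first by rewrite /block size_takel // size_drop; size_lia.
move=> j; rewrite /block size_takel ?size_drop; last size_lia.
move=> hj; rewrite nth_take // nth_drop.
by case: j hj => [|[|j]] //= _; congr nth; size_lia.
Qed.

Lemma subst_block_pair i X s : (1 <= i)%N ->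
  subst_block i 2 X s = take i.-1 s ++ X :: drop i.+1 s.
Proof. by move=> hi; rewrite /subst_block; have -> : (i.-1 + 2 = i.+1)%N by size_lia. Qed.

Variable n : nat.

Lemma block_head s : block 1 n.+1 s = take n.+1 s.
Proof. by rewrite /block drop0. Qed.

Lemma block_tail s : size s = n.+2 -> block 2 n.+1 s = behead s.
Proof. by move=> hs; rewrite /block /= drop1 take_oversize // size_behead; size_lia. Qed.

Lemma subst_block_head X s : size s = n.+2 ->
  subst_block 1 n.+1 X s = [:: X; nth 0 s n.+1].
Proof.
by move=> hs; rewrite /subst_block take0 add0n (drop_nth 0) ?drop_oversize //; size_lia.
Qed.

Lemma subst_block_tail X s : size s = n.+2 ->
  subst_block 2 n.+1 X s = [:: nth 0 s 0; X].
Proof.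
move=> hs; rewrite /subst_block /= drop_oversize; last size_lia.
by case: s hs => [|a s'] //= _; rewrite take0.
Qed.

Lemma behead_take s : behead (take n.+1 s) = take n (behead s).
Proof. by case: s. Qed.

Lemma take_contract o i s : size s = n.+2 -> (1 <= i <= n)%N ->
  take n (contract o i s) = contract o i (take n.+1 s).
Proof.
move=> hs hi; apply: (@eq_from_nth _ 0).
  by rewrite size_takel ?size_contract ?size_takel; size_lia.
move=> j; rewrite size_takel ?size_contract; try size_lia.
move=> hj; rewrite nth_take // !nth_contract ?size_takel; try size_lia.
by case_ifs; rewrite !nth_take; try congr_index; size_lia.
Qed.

Lemma take_contract_last o s : size s = n.+2 -> take n (contract o n.+1 s) = take n s.
Proof.
move=> hs; apply: (@eq_from_nth _ 0); first by rewrite !size_takel ?size_contract; size_lia.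
move=> j; rewrite size_takel ?size_contract; try size_lia.
by move=> hj; rewrite !nth_take // !nth_contract; try size_lia; case_ifs; congr_index.
Qed.

Lemma nthn_contract o i s : size s = n.+2 -> (1 <= i <= n)%N ->
  nth 0 (contract o i s) n = nth 0 s n.+1.
Proof. by move=> hs hi; rewrite nth_contract; [case_ifs | size_lia]. Qed.

Lemma nthn_contract_last o s : size s = n.+2 ->
  nth 0 (contract o n.+1 s) n = o (nth 0 s n) (nth 0 s n.+1).
Proof. by move=> hs; rewrite nth_contract; [case_ifs | size_lia]. Qed.

End Contraction.

Section Multilinear.
Variables (k : fieldType) (A : lmodType k) (n : nat) (f : seq A -> A).
Hypothesis f_mlin : multilinear n f.
Implicit Types (L R : seq A).

Lemma mlin_cat L R c x y : (size L + (size R).+1 = n)%N ->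
  f (L ++ (c *: x + y) :: R) = c *: f (L ++ x :: R) + f (L ++ y :: R).
Proof.
have set_nth_cat z : set_nth 0 (L ++ 0 :: R) (size L) z = L ++ z :: R.
  by elim: L => //= a L ->.
move=> hLR; rewrite -[L ++ _ :: R]set_nth_cat -[L ++ x :: R]set_nth_cat.
rewrite -[L ++ y :: R]set_nth_cat; apply: f_mlin; first by rewrite size_cat.
size_lia.
Qed.

Lemma mlin_catD L R x y : (size L + (size R).+1 = n)%N ->
  f (L ++ (x + y) :: R) = f (L ++ x :: R) + f (L ++ y :: R).
Proof. by move=> hLR; have := mlin_cat 1 x y hLR; rewrite !scale1r. Qed.

End Multilinear.

Section DoubleContraction.
Variables (k : fieldType) (A : lmodType k) (n : nat) (f : seq A -> A) (s : seq A).
Hypothesis f_mlin : multilinear n f.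
Hypothesis size_s : size s = n.+2.
Implicit Types (o : A -> A -> A).

Definition dcontr o1 o2 := \sum_(1 <= i < n.+2) \sum_(1 <= j < n.+1)
  sgn (i + j) (f (contract o2 j (contract o1 i s))).

Let far_pair o1 o2 p q :=
  if (p.+2 <= q)%N then
    sgn (p + q) (f (contract o1 p (contract o2 q s)))
    + sgn (p + q) (f (contract o2 p (contract o1 q s)))
  else 0.

Let left_nested o1 o2 p :=
  f (contract o2 p (contract o1 p s)) + f (contract o1 p (contract o2 p s)).

Let right_nested o1 o2 p :=
  f (contract o2 p (contract o1 p.+1 s)) + f (contract o1 p (contract o2 p.+1 s)).

(* Contractions at non-overlapping positions commute up to a shift of the
   later position (contractC): off the two diagonals j = i - 1 and j = i, the
   symmetrised terms telescope. *)
Lemma dcontr_term_split o1 o2 i j : (1 <= i < n.+2)%N -> (1 <= j < n.+1)%N ->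
  sgn (i + j) (f (contract o2 j (contract o1 i s)))
  + sgn (i + j) (f (contract o1 j (contract o2 i s)))
  = far_pair o1 o2 j i - far_pair o1 o2 i j.+1
    + (if j == i.-1 then - right_nested o1 o2 j else 0)
    + (if j == i then left_nested o1 o2 i else 0).
Proof.
move=> hi hj; rewrite /far_pair /left_nested /right_nested.
have [hji|hij|<-] := ltngtP j.+1 i.
- by case_ifs; rewrite (addnC j i); zmod_eq.
- have [hji'|hij'|->] := ltngtP j i; first by exfalso; size_lia.
  + case_ifs; rewrite -!(@contractC _ _ _ _ i j.+1) //; try size_lia.
    by rewrite addnS sgnS (sgnS _ (f (contract o2 i _))); zmod_eq.
  + by case_ifs; rewrite !sgnE addnn odd_double; zmod_eq.
- by case_ifs; rewrite !sgnE addSn addnn oddS odd_double /=; zmod_eq.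
Qed.

Lemma dcontr_sym o1 o2 : dcontr o1 o2 + dcontr o2 o1 =
  \sum_(1 <= p < n.+1) (left_nested o1 o2 p - right_nested o1 o2 p).
Proof.
rewrite /dcontr -big_split /=; set rhs := (X in _ = X).
under eq_big_nat => i hi do
  rewrite -big_split /= (eq_big_nat _ _ (fun j hj => dcontr_term_split o1 o2 hi hj)).
under eq_bigr => i _ do rewrite !big_split /= sumrN.
rewrite !big_split /= sumrN.
have far_cancel : \sum_(1 <= i < n.+2) \sum_(1 <= j < n.+1) far_pair o1 o2 j i
               = \sum_(1 <= i < n.+2) \sum_(1 <= j < n.+1) far_pair o1 o2 i j.+1.
  transitivity (\sum_(1 <= i < n.+2) \sum_(1 <= j < n.+2) far_pair o1 o2 j i).
    apply: eq_big_nat => i hi; rewrite [RHS]big_nat_recr //=.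
    have -> : far_pair o1 o2 n.+1 i = 0 by rewrite /far_pair; case_ifs.
    by rewrite addr0.
  rewrite exchange_big_nat; apply: eq_big_nat => i hi.
  rewrite -(big_add1 _ _ 1 n.+2 xpredT (fun q => far_pair o1 o2 i q)) big_ltn //.
  have -> : far_pair o1 o2 i 1 = 0 by rewrite /far_pair; case_ifs.
  exact: add0r.
have right_diag : \sum_(1 <= i < n.+2) \sum_(1 <= j < n.+1)
    (if j == i.-1 then - right_nested o1 o2 j else 0)
  = \sum_(1 <= p < n.+1) - right_nested o1 o2 p.
  under eq_bigr => i _ do rewrite (sum_nat_eq (fun j => - right_nested o1 o2 j)).
  rewrite big_ltn //= add0r big_add1 /=; apply: eq_big_nat => i hi.
  by rewrite ifT //; size_lia.
have left_diag : \sum_(1 <= i < n.+2) \sum_(1 <= j < n.+1)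
    (if j == i then left_nested o1 o2 i else 0)
  = \sum_(1 <= p < n.+1) left_nested o1 o2 p.
  under eq_bigr => i _ do rewrite (sum_nat_eq (fun j => left_nested o1 o2 i)).
  rewrite big_nat_recr //= ifF ?addr0; last size_lia.
  by apply: eq_big_nat => i hi; rewrite ifT //; size_lia.
by rewrite far_cancel subrr add0r right_diag left_diag /rhs sumrB sumrN addrC.
Qed.

Lemma dcontr_anti o1 o2 :
    (forall x y z, o2 (o1 x y) z + o1 (o2 x y) z = o2 x (o1 y z) + o1 x (o2 y z)) ->
  dcontr o1 o2 + dcontr o2 o1 = 0.
Proof.
move=> compat; rewrite dcontr_sym big_nat_cond big1 // => p /andP[/andP[hp1 hp2] _].
rewrite /left_nested /right_nested !contract2_right ?contract2_left; try size_lia.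
have hsize : (size (take p.-1 s) + (size (drop p.+2 s)).+1 = n)%N.
  by rewrite size_takel ?size_drop; size_lia.
by rewrite -!(mlin_catD f_mlin) // compat subrr.
Qed.

End DoubleContraction.

Section ThetaCochainMap.
Variables (k : fieldType) (A : lmodType k) (mul : A -> A -> A) (N : A -> A).
Hypothesis mulZDl : forall (c : k) (x y z : A), mul (c *: x + y) z = c *: mul x z + mul y z.
Hypothesis mulZDr : forall (c : k) (x y z : A), mul z (c *: x + y) = c *: mul z x + mul z y.
Hypothesis mulA : forall x y z : A, mul (mul x y) z = mul x (mul y z).
Hypothesis N_lin : forall (c : k) (x y : A), N (c *: x + y) = c *: N x + N y.

Let mul_linl z : forall c x y, mul (c *: x + y) z = c *: mul x z + mul y z :=
  fun c x y => mulZDl c x y z.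
Let mul_linr z : forall c x y, mul z (c *: x + y) = c *: mul z x + mul z y :=
  fun c x y => mulZDr c x y z.

Lemma mul0l z : mul 0 z = 0.
Proof. exact: (@lin0 _ _ (mul^~ z) (mul_linl z)). Qed.

Lemma mul0r z : mul z 0 = 0.
Proof. exact: (@lin0 _ _ (mul z) (mul_linr z)). Qed.

Lemma mulDl x y z : mul (x + y) z = mul x z + mul y z.
Proof. exact: (@linD _ _ (mul^~ z) (mul_linl z)). Qed.

Lemma mulDr x y z : mul z (x + y) = mul z x + mul z y.
Proof. exact: (@linD _ _ (mul z) (mul_linr z)). Qed.

Lemma mulNl x z : mul (- x) z = - mul x z.
Proof. exact: (@linN _ _ (mul^~ z) (mul_linl z)). Qed.

Lemma mulNr x z : mul z (- x) = - mul z x.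
Proof. exact: (@linN _ _ (mul z) (mul_linr z)). Qed.

Lemma mulBl x y z : mul (x - y) z = mul x z - mul y z.
Proof. exact: (@linB _ _ (mul^~ z) (mul_linl z)). Qed.

Lemma mulBr x y z : mul z (x - y) = mul z x - mul z y.
Proof. exact: (@linB _ _ (mul z) (mul_linr z)). Qed.

Lemma mul_sgnl e x z : mul (sgn e x) z = sgn e (mul x z).
Proof. exact: (@lin_sgn _ _ (mul^~ z) (mul_linl z)). Qed.

Lemma mul_sgnr e x z : mul z (sgn e x) = sgn e (mul z x).
Proof. exact: (@lin_sgn _ _ (mul z) (mul_linr z)). Qed.

Lemma mul_sum_sgnl z (E : nat -> nat) (X : nat -> A) (r : seq nat) :
  mul (\sum_(i <- r) sgn (E i) (X i)) z = \sum_(i <- r) sgn (E i) (mul (X i) z).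
Proof.
by rewrite (@lin_sum _ _ (mul^~ z) (mul_linl z)); apply: eq_bigr => i _; rewrite mul_sgnl.
Qed.

Lemma mul_sum_sgnr z (E : nat -> nat) (X : nat -> A) (r : seq nat) :
  mul z (\sum_(i <- r) sgn (E i) (X i)) = \sum_(i <- r) sgn (E i) (mul z (X i)).
Proof.
by rewrite (@lin_sum _ _ (mul z) (mul_linr z)); apply: eq_bigr => i _; rewrite mul_sgnr.
Qed.

Lemma N_sum_sgn (E : nat -> nat) (X : nat -> A) (r : seq nat) :
  N (\sum_(i <- r) sgn (E i) (X i)) = \sum_(i <- r) sgn (E i) (N (X i)).
Proof. by rewrite (lin_sum N_lin); apply: eq_bigr => i _; rewrite (lin_sgn N_lin). Qed.

Lemma brN_mul_compat x y z :
  brN mul N (mul x y) z + mul (brN mul N x y) z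
  = brN mul N x (mul y z) + mul x (brN mul N y z).
Proof.
rewrite /brN !(mulDl, mulDr, mulBl, mulBr, linD N_lin, linB N_lin, mulNl, mulNr) !mulA.
zmod_eq.
Qed.

Lemma sum_piN x y : \sum_(1 <= j < 4) piN mul N j [:: x; y] = brN mul N x y.
Proof. by rewrite big_ltn // big_ltn // big_ltn // big_geq // /piN /brN /=; zmod_eq. Qed.

Section Theta.
Variables (m : nat) (g : seq A -> A) (t : seq A).

Lemma Theta1 : Theta mul m g 1 t = sgn m.+1 (mul (nth 0 t 0) (g (behead t))).
Proof. by []. Qed.

Lemma Theta_mid r : (2 <= r <= m)%N -> Theta mul m g r t = 0.
Proof. by move=> hr; rewrite /Theta; case_ifs. Qed.

Lemma Theta_last : (1 <= m)%N -> Theta mul m g m.+1 t = mul (g (take m t)) (nth 0 t m).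
Proof. by move=> hm; rewrite /Theta; case_ifs. Qed.

Lemma Theta_contr :
  Theta mul m g m.+2 t = \sum_(1 <= i < m.+1) sgn (m + i + 1) (g (contract mul i t)).
Proof. by rewrite /Theta; case_ifs. Qed.

Lemma sum_Theta : (1 <= m)%N ->
  \sum_(1 <= j < m.+3) Theta mul m g j t = sgn m.+1 (hoch mul m g t).
Proof.
move=> hm; rewrite big_ltn // big_nat_recr //= big_nat_recr /=; last size_lia.
rewrite big_nat_cond big1 => [|j /andP[/andP[hj1 hj2] _]]; last first.
  by apply: Theta_mid; size_lia.
rewrite add0r Theta1 Theta_last // Theta_contr /hoch !sgnDr sgn_sum sgnK.
have -> : \sum_(1 <= i < m.+1) sgn m.+1 (sgn i (g (contract mul i t)))
        = \sum_(1 <= i < m.+1) sgn (m + i + 1) (g (contract mul i t)).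
  by apply: eq_bigr => i _; rewrite -sgnD; apply: eq_sgn; size_lia.
zmod_eq.
Qed.

End Theta.

Section Components.
Variables (n : nat) (f : seq A -> A) (s : seq A).
Hypothesis n_gt0 : (1 <= n)%N.
Hypothesis f_mlin : multilinear n f.
Hypothesis size_s : size s = n.+2.
Hypothesis char0 : [pchar k] =i pred0.

Local Notation F := (Theta mul n f).
Local Notation pi := (piN mul N).
Local Notation brN' := (brN mul N).
Local Notation dcontr_s := (dcontr n f s).

Lemma dcontr_brN : dcontr_s mul brN' + dcontr_s brN' mul = 0.
Proof. exact: (dcontr_anti (o1 := mul) (o2 := brN') f_mlin size_s brN_mul_compat). Qed.

Lemma dcontr_mul : dcontr_s mul mul = 0.
Proof.
apply: (double_eq0 char0).
by apply: (dcontr_anti (o1 := mul) (o2 := mul) f_mlin size_s) => x y z; rewrite mulA.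
Qed.

Lemma deltaNS_expand r :
  deltaNS pi n.+1 F r s =
    sgn n (pcomp 2 n.+1 1 pi F r s + sgn n (pcomp 2 n.+1 2 pi F r s)
           - sgn n (\sum_(1 <= i < n.+2) sgn i.-1 (pcomp n.+1 2 i F pi r s))).
Proof.
rewrite /deltaNS /nsbracket big_ltn // big_ltn // big_geq // addr0.
have -> : (n.+1 - 1 = n)%N by size_lia.
have -> : ((1 - 1) * n = 0)%N by size_lia.
have -> : ((2 - 1) * n = n)%N by size_lia.
rewrite sgn0; congr (sgn _ (_ + _ - sgn _ _)).
by apply: eq_big_nat => i hi; have -> : ((i - 1) * (2 - 1) = i.-1)%N by size_lia.
Qed.

Lemma pcomp_pi1_low r : (1 <= r <= n.+1)%N ->
  pcomp 2 n.+1 1 pi F r s = mul (F r (take n.+1 s)) (N (s`_n.+1)).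
Proof.
move=> hr; rewrite /pcomp block_head; case_ifs; rewrite !subst_block_head //.
by have -> : (r - 1 + 1 = r)%N by size_lia.
Qed.

Lemma pcomp_pi1_n2 : pcomp 2 n.+1 1 pi F n.+2 s =
  mul (N (\sum_(1 <= j < n.+3) F j (take n.+1 s))) (s`_n.+1).
Proof.
rewrite /pcomp block_head; case_ifs; rewrite !subst_block_head //.
by have -> : (n.+2 - n.+1 + 1 = 2)%N by size_lia.
Qed.

Lemma pcomp_pi1_n3 : pcomp 2 n.+1 1 pi F n.+3 s =
  mul (F n.+2 (take n.+1 s)) (N (s`_n.+1))
  - N (mul (\sum_(1 <= j < n.+3) F j (take n.+1 s)) (s`_n.+1)).
Proof. by rewrite /pcomp block_head; case_ifs; rewrite !subst_block_head //. Qed.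

Lemma pcomp_pi2_1 : pcomp 2 n.+1 2 pi F 1 s =
  mul s`_0 (N (\sum_(1 <= j < n.+3) F j (behead s))).
Proof. by rewrite /pcomp block_tail //; case_ifs; rewrite !subst_block_tail //. Qed.

Lemma pcomp_pi2_mid r : (2 <= r <= n.+2)%N ->
  pcomp 2 n.+1 2 pi F r s = mul (N (s`_0)) (F r.-1 (behead s)).
Proof.
move=> hr; rewrite /pcomp block_tail //; case_ifs; rewrite !subst_block_tail //.
by have -> : (r - 2 + 1 = r.-1)%N by size_lia.
Qed.

Lemma pcomp_pi2_n3 : pcomp 2 n.+1 2 pi F n.+3 s =
  mul (N (s`_0)) (F n.+2 (behead s))
  - N (mul s`_0 (\sum_(1 <= j < n.+3) F j (behead s))).
Proof. by rewrite /pcomp block_tail //; case_ifs; rewrite !subst_block_tail //. Qed.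

Lemma pcomp_F_low r i : (1 <= i <= n.+1)%N -> (r <= i.-1)%N ->
  pcomp n.+1 2 i F pi r s = F r (contract brN' i s).
Proof.
move=> hi hr; rewrite /pcomp block_pair; last size_lia.
by case_ifs; rewrite sum_piN subst_block_pair; [|size_lia].
Qed.

Lemma pcomp_F_at r i : (1 <= i <= n.+1)%N -> (i.-1 < r <= i.+1)%N ->
  pcomp n.+1 2 i F pi r s = F i (contract (fun x y => pi (r - i + 1) [:: x; y]) i s).
Proof.
move=> hi hr; rewrite /pcomp block_pair; last size_lia.
by case_ifs; rewrite subst_block_pair; [|size_lia].
Qed.

Lemma pcomp_F_high r i : (1 <= i <= n.+1)%N -> (i.+1 < r <= n.+2)%N ->
  pcomp n.+1 2 i F pi r s = F r.-1 (contract brN' i s).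
Proof.
move=> hi hr; rewrite /pcomp block_pair; last size_lia.
case_ifs; rewrite sum_piN subst_block_pair; last size_lia.
by have -> : (r - 2 + 1 = r.-1)%N by size_lia.
Qed.

Lemma pcomp_F_n3 i : (1 <= i <= n.+1)%N ->
  pcomp n.+1 2 i F pi n.+3 s = F i (contract (fun x y => pi 3 [:: x; y]) i s)
     + F n.+2 (contract brN' i s).
Proof.
move=> hi; rewrite /pcomp block_pair; last size_lia.
by case_ifs; rewrite sum_piN !subst_block_pair //; size_lia.
Qed.

Lemma deltaNS_Theta1 : deltaNS pi n.+1 F 1 s = Theta mul n.+1 (dN mul N n f) 1 s.
Proof.
rewrite deltaNS_expand pcomp_pi1_low // pcomp_pi2_1 sum_Theta // big_ltn // big_add1 /=.
rewrite pcomp_F_at //.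
have sum_pcomp_F : \sum_(1 <= i < n.+1) sgn i (pcomp n.+1 2 i.+1 F pi 1 s)
  = sgn n.+1 (\sum_(1 <= i < n.+1) sgn i (mul s`_0 (f (contract brN' i (behead s))))).
  rewrite sgn_sum; apply: eq_big_nat => i hi.
  rewrite pcomp_F_low; try size_lia.
  rewrite Theta1 nth0_contract ?behead_contract /=; try size_lia.
  by rewrite sgnC.
rewrite sum_pcomp_F !Theta1 nth0_contract1 ?behead_contract1 ?size_s // /dN.
rewrite behead_take !nth_behead /=.
rewrite !(mulDr, mulBr, mulNr, mul_sum_sgnr, mul_sgnr, mul_sgnl, lin_sgn N_lin, mulA).
rewrite nth_take //= !(sgnDr, sgnB, sgnN, sgn0).
by rewrite !sgnE /=; case: (odd n); rewrite /= ?opprK; zmod_eq.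
Qed.

Lemma sum_pcomp_F_mid r : (2 <= r <= n.+1)%N ->
  \sum_(1 <= i < n.+2) sgn i.-1 (pcomp n.+1 2 i F pi r s) =
    (if r == 2 then sgn n.+1 (mul (N s`_0) (mul s`_1 (f (behead (behead s))))) else 0)
    + sgn n (if r == n.+1 then mul (f (take n s)) (mul s`_n (N s`_n.+1)) else 0).
Proof.
move=> hr; rewrite big_nat_split_ends // big_nat_cond big1 ?addr0; last first.
  move=> i /andP[/andP[hi1 hi2] _].
  have [hri|hri] := leqP r i.-1; first by rewrite pcomp_F_low ?Theta_mid ?sgnr0 //; size_lia.
  have [hri'|hri'] := leqP r i.+1; first by rewrite pcomp_F_at ?Theta_mid ?sgnr0 //; size_lia.
  by rewrite pcomp_F_high ?Theta_mid ?sgnr0 //; size_lia.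
congr (_ + _); case: eqP => [->|hr'].
- rewrite pcomp_F_at //= sgn0 Theta1 nth0_contract1 ?behead_contract1 ?size_s //=.
  by rewrite mulA.
- by rewrite pcomp_F_high ?Theta_mid ?sgn0 //; size_lia.
- rewrite pcomp_F_at; try size_lia.
  have -> : (n.+1 - n.+1 + 1 = 1)%N by size_lia.
  by rewrite Theta_last // take_contract_last // nthn_contract_last.
- by rewrite pcomp_F_low ?Theta_mid ?sgnr0 //; size_lia.
Qed.

Lemma deltaNS_Theta_mid r : (2 <= r <= n.+1)%N ->
  deltaNS pi n.+1 F r s = Theta mul n.+1 (dN mul N n f) r s.
Proof.
move=> hr; rewrite Theta_mid // deltaNS_expand pcomp_pi1_low ?pcomp_pi2_mid; try size_lia.
have -> : mul (F r (take n.+1 s)) (N s`_n.+1) =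
    if r == n.+1 then mul (f (take n s)) (mul s`_n (N s`_n.+1)) else 0.
  case: eqP => [->|hr']; first by rewrite Theta_last // take_takel // nth_take // mulA.
  by rewrite Theta_mid ?mul0l //; size_lia.
have -> : mul (N s`_0) (F r.-1 (behead s)) =
    if r == 2 then sgn n.+1 (mul (N s`_0) (mul s`_1 (f (behead (behead s))))) else 0.
  case: eqP => [->|hr']; first by rewrite Theta1 mul_sgnr nth_behead.
  by rewrite Theta_mid ?mul0r //; size_lia.
rewrite sum_pcomp_F_mid //.
by case: eqP => _; case: eqP => _; rewrite ?sgnr0 ?sgnK ?(sgnDr, sgnB, sgnN, sgn0);
  rewrite ?sgnE /=; case: (odd n); rewrite /= ?opprK ?oppr0; zmod_eq.
Qed.
Lemma deltaNS_Theta_n2 : deltaNS pi n.+1 F n.+2 s = Theta mul n.+1 (dN mul N n f) n.+2 s.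
Proof.
rewrite Theta_last // deltaNS_expand pcomp_pi1_n2 pcomp_pi2_mid ?sum_Theta //; try size_lia.
rewrite big_nat_recr //= pcomp_F_at; try size_lia.
have -> : (n.+2 - n.+1 + 1 = 2)%N by size_lia.
rewrite !Theta_last // take_contract_last // nthn_contract_last //=.
have sum_pcomp_F : \sum_(1 <= i < n.+1) sgn i.-1 (pcomp n.+1 2 i F pi n.+2 s)
  = - \sum_(1 <= i < n.+1) sgn i (mul (f (contract brN' i (take n.+1 s))) (s`_n.+1)).
  rewrite -sumrN; apply: eq_big_nat => i hi.
  rewrite pcomp_F_high; try size_lia.
  rewrite /= Theta_last // take_contract // nthn_contract //; try size_lia.
  by case: i hi => [|i] hi //=; rewrite sgnS opprK.
rewrite sum_pcomp_F /dN behead_take !nth_take // take_takel // nth_behead.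
rewrite !(mulDl, mulBl, mulNl, mul_sum_sgnl, mul_sgnr, mul_sgnl, lin_sgn N_lin, mulA).
rewrite !(sgnDr, sgnB, sgnN, sgn0, sgnK).
by rewrite !sgnE /=; case: (odd n); rewrite /= ?opprK; zmod_eq.
Qed.

Lemma sum_hoch_contract :
  \sum_(1 <= i < n.+2) sgn (n.+1 + i + 1) (hoch mul n f (contract mul i s))
  = sgn n (mul (\sum_(1 <= j < n.+3) F j (take n.+1 s)) s`_n.+1)
    + mul s`_0 (\sum_(1 <= j < n.+3) F j (behead s)).
Proof.
rewrite !sum_Theta // /hoch.
under eq_bigr => i _ do rewrite !sgnDr.
rewrite !big_split /=.
have -> : \sum_(1 <= i < n.+2) sgn (n.+1 + i + 1)
    (mul (contract mul i s)`_0 (f (behead (contract mul i s))))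
  = sgn n.+1 (mul (mul s`_0 s`_1) (f (behead (behead s))))
    + sgn n.+1 (\sum_(1 <= i < n.+1) sgn i (mul s`_0 (f (contract mul i (behead s))))).
  rewrite big_ltn // big_add1 /= nth0_contract1 ?behead_contract1 ?size_s //.
  congr (_ + _); first by apply: eq_sgn; size_lia.
  apply: eq_sum_sgn => i hi.
  rewrite nth0_contract ?behead_contract /=; try size_lia.
  by rewrite -sgnD; apply: eq_sgn; size_lia.
have -> : \sum_(1 <= i < n.+2) sgn (n.+1 + i + 1)
    (\sum_(1 <= j < n.+1) sgn j (f (contract mul j (contract mul i s))))
  = sgn n (dcontr_s mul mul).
  rewrite /dcontr sgn_sum; apply: eq_big_nat => i hi; rewrite !sgn_sum.
  by apply: eq_bigr => j _; rewrite -!sgnD; apply: eq_sgn; size_lia.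
have -> : \sum_(1 <= i < n.+2) sgn (n.+1 + i + 1)
    (sgn n.+1 (mul (f (take n (contract mul i s))) (contract mul i s)`_n))
  = sgn 1 (\sum_(1 <= i < n.+1) sgn i (mul (f (contract mul i (take n.+1 s))) s`_n.+1))
    + sgn n (mul (f (take n s)) (mul s`_n s`_n.+1)).
  rewrite big_nat_recr //= take_contract_last // nthn_contract_last //.
  congr (_ + _); last by rewrite -sgnD; apply: eq_sgn; size_lia.
  apply: eq_sum_sgn => i hi.
  rewrite take_contract ?nthn_contract //; try size_lia.
  by rewrite -!sgnD; apply: eq_sgn; size_lia.
rewrite dcontr_mul sgnr0 addr0.
rewrite nth_take // behead_take take_takel // nth_take // !nth_behead.
rewrite !(mulDl, mulDr, mul_sum_sgnl, mul_sum_sgnr, mul_sgnl, mul_sgnr, mulA).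
rewrite !(sgnDr, sgnB, sgnN, sgn0, sgnK).
by rewrite !sgnE /=; case: (odd n); rewrite /= ?opprK; zmod_eq.
Qed.

Lemma sum_pcomp_F_n3 :
  \sum_(1 <= i < n.+2) sgn i.-1 (pcomp n.+1 2 i F pi n.+3 s)
  = sgn n.+1 (- mul (N (mul s`_0 s`_1)) (f (behead (behead s))))
    + sgn n (- mul (f (take n s)) (N (mul s`_n s`_n.+1))) + sgn n (dcontr_s brN' mul).
Proof.
transitivity (\sum_(1 <= i < n.+2)
    (sgn i.-1 (F i (contract (fun x y => pi 3 [:: x; y]) i s))
     + sgn i.-1 (F n.+2 (contract brN' i s)))).
  by apply: eq_big_nat => i hi; rewrite pcomp_F_n3 ?sgnDr //; size_lia.
rewrite big_split /=; congr (_ + _).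
  rewrite big_nat_split_ends // big_nat_cond big1 ?addr0; last first.
    by move=> i /andP[/andP[hi1 hi2] _]; rewrite Theta_mid ?sgnr0 //; size_lia.
  rewrite /= sgn0 Theta1 nth0_contract1 ?behead_contract1 ?size_s //= Theta_last //.
  by rewrite take_contract_last // nthn_contract_last //= mulNl mulNr.
rewrite /dcontr sgn_sum; apply: eq_big_nat => i hi; rewrite Theta_contr !sgn_sum.
by apply: eq_bigr => j _; rewrite -!sgnD; apply: eq_sgn; size_lia.
Qed.

Lemma sum_dN_contract :
  \sum_(1 <= i < n.+2) sgn (n.+1 + i + 1) (dN mul N n f (contract mul i s))
  = sgn n.+1 (mul (N (mul s`_0 s`_1)) (f (behead (behead s))))
    + sgn n.+1 (\sum_(1 <= i < n.+1) sgn i (mul (N s`_0) (f (contract mul i (behead s)))))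
    - sgn 1 (sgn n (mul (f (take n s)) (N (mul s`_n s`_n.+1))))
    - \sum_(1 <= i < n.+1) sgn i (mul (f (contract mul i (take n.+1 s))) (N s`_n.+1))
    + sgn n (dcontr_s mul brN')
    - N (\sum_(1 <= i < n.+2) sgn (n.+1 + i + 1) (hoch mul n f (contract mul i s))).
Proof.
rewrite N_sum_sgn /dN.
under eq_bigr => i _ do rewrite !(sgnDr, sgnN).
rewrite !big_split /= !sumrN.
have -> : \sum_(1 <= i < n.+2) sgn (n.+1 + i + 1)
    (mul (N (contract mul i s)`_0) (f (behead (contract mul i s))))
  = sgn n.+1 (mul (N (mul s`_0 s`_1)) (f (behead (behead s))))
    + sgn n.+1 (\sum_(1 <= i < n.+1) sgn i (mul (N s`_0) (f (contract mul i (behead s))))).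
  rewrite big_ltn // big_add1 /= nth0_contract1 ?behead_contract1 ?size_s //.
  congr (_ + _); first by apply: eq_sgn; size_lia.
  apply: eq_sum_sgn => i hi.
  rewrite nth0_contract ?behead_contract /=; try size_lia.
  by rewrite -sgnD; apply: eq_sgn; size_lia.
have -> : \sum_(1 <= i < n.+2) sgn (n.+1 + i + 1)
    (sgn n (mul (f (take n (contract mul i s))) (N (contract mul i s)`_n)))
  = sgn 1 (sgn n (mul (f (take n s)) (N (mul s`_n s`_n.+1))))
    + \sum_(1 <= i < n.+1) sgn i (mul (f (contract mul i (take n.+1 s))) (N s`_n.+1)).
  rewrite big_nat_recr //= take_contract_last // nthn_contract_last // addrC.
  congr (_ + _); first by apply: eq_sgn; size_lia.
  rewrite -[RHS]sgn0; apply: eq_sum_sgn => i hi.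
  rewrite take_contract ?nthn_contract //; try size_lia.
  by rewrite -!sgnD; apply: eq_sgn; size_lia.
have -> : \sum_(1 <= i < n.+2) sgn (n.+1 + i + 1)
    (\sum_(1 <= j < n.+1) sgn j (f (contract brN' j (contract mul i s))))
  = sgn n (dcontr_s mul brN').
  rewrite /dcontr sgn_sum; apply: eq_big_nat => i hi; rewrite !sgn_sum.
  by apply: eq_bigr => j _; rewrite -!sgnD; apply: eq_sgn; size_lia.
zmod_eq.
Qed.

Lemma deltaNS_Theta_n3 : deltaNS pi n.+1 F n.+3 s = Theta mul n.+1 (dN mul N n f) n.+3 s.
Proof.
rewrite deltaNS_expand pcomp_pi1_n3 pcomp_pi2_n3 [RHS]Theta_contr.
rewrite sum_pcomp_F_n3 sum_dN_contract sum_hoch_contract.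
have -> : dcontr_s brN' mul = - dcontr_s mul brN'.
  by apply/eqP; rewrite -subr_eq0 opprK addrC dcontr_brN.
have shift (X : nat -> A) : \sum_(1 <= i < n.+1) sgn (n + i + 1) (X i)
                          = sgn n.+1 (\sum_(1 <= i < n.+1) sgn i (X i)).
  by apply: eq_sum_sgn => i _; rewrite -sgnD; apply: eq_sgn; size_lia.
rewrite !Theta_contr mul_sum_sgnl mul_sum_sgnr !shift.
rewrite !(linD N_lin, linB N_lin, linN N_lin, lin_sgn N_lin, mulNl, mulNr).
rewrite !(sgnDr, sgnB, sgnN, sgn0, sgnK).
by rewrite !sgnE /=; case: (odd n); rewrite /= ?opprK; zmod_eq.
Qed.

End Components.

End ThetaCochainMap.

Unset Implicit Arguments.

Theorem proposition2p16 (k : fieldType) (A : lmodType k)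
    (mul : A -> A -> A) (N : A -> A) :
  [pchar k] =i pred0 ->
  (forall (c : k) (x y z : A), mul (c *: x + y) z = c *: mul x z + mul y z) ->
  (forall (c : k) (x y z : A), mul z (c *: x + y) = c *: mul z x + mul z y) ->
  (forall x y z : A, mul (mul x y) z = mul x (mul y z)) ->
  (forall (c : k) (x y : A), N (c *: x + y) = c *: N x + N y) ->
  is_Nijenhuis mul N ->
  forall (n : nat) (f : seq A -> A), (1 <= n)%N -> multilinear n f ->
  forall (r : nat) (s : seq A), (1 <= r <= n.+3)%N -> size s = n.+2 ->
    deltaNS (piN mul N) n.+1 (Theta mul n f) r s
    = Theta mul n.+1 (dN mul N n f) r s.
Proof.
move=> char0 mulZDl mulZDr mulA N_lin _ n f n_gt0 f_mlin r s hr size_s.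
have [->|r_neq1] := eqVneq r 1%N; first exact: deltaNS_Theta1.
have [r_le|r_gt] := leqP r n.+1; first by apply: deltaNS_Theta_mid => //; size_lia.
have [->|r_neq] := eqVneq r n.+2; first exact: deltaNS_Theta_n2.
have -> : r = n.+3 by size_lia.
exact: deltaNS_Theta_n3.
Qed.
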